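(* The second-price auction (SPA) is risk-averse auto-bidding incentive compatible (RAIC) in the setting of non-uniform bidding tCPA auto-bidders. That is: for every finite set $A$ of advertisers, every finite set $Q$ of queries, all values $v_{i,j}\ge 0$ ($i\in A$, $j\in Q$), every advertiser $i\in A$ with true target $T_i>0$, every choice of fixed reported targets $T_\ell>0$ of the other advertisers $\ell\ne i$, and every report $0<T_i'\le T_i$, $$\min_{\pi\in\Pi(T_i)^{\mathrm{Eq}}}\mathrm{LW}_i(\pi)\ \ge\ \min_{\pi\in\Pi(T_i')^{\mathrm{Eq}}}\mathrm{LW}_i(\pi).$$
   Context: Setting. $A$ is a finite set of at least two advertisers and $Q$ a finite set of queries; bidder $i$ has value $v_{i,j}\ge0$ for query $j$. Each advertiser $i$ reports a target to its own auto-bidder, which then places a bid $b_{i,j}\in[0,\infty)$ on each query $j$; bids on different queries may be arbitrary and unrelated (non-uniform bidding). Second-price auction: each query $j$ is sold separately to a bidder with the highest bid on $j$ (ties broken by a fixed deterministic rule). $\pi_{i,j}\in\{0,1\}$ indicates whether $i$ wins $j$, so $\sum_{i}\pi_{i,j}=1$. If $i$ wins $j$ it pays $c_{i,j}=\max_{\ell\ne i}b_{\ell,j}$. Auto-bidder equilibrium. Let the reported targets be $(S_i)_{i\in A}$. A bid profile $(b_{i,j})$ with allocation $\pi$ and costs $c$ is an auto-bidder equilibrium if for every bidder $i$: (0) undominated bids: $b_{i,j}\ge S_i v_{i,j}$ for all $j\in Q$; (1) tCPA constraint: $\sum_{j}\pi_{i,j}c_{i,j}\le S_i\sum_j\pi_{i,j}v_{i,j}$;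 (2) stability: for every deviation of $i$ to bids $(b'_{i,j})_{j\in Q}$, all other bids being unchanged, with resulting allocation $\pi'$ and costs $c'$, at least one of the following holds: $S_i\sum_j\pi'_{i,j}v_{i,j}\le S_i\sum_j\pi_{i,j}v_{i,j}$, or $\sum_j\pi'_{i,j}c'_{i,j}>S_i\sum_j\pi'_{i,j}v_{i,j}$. With the reports of all advertisers other than $i$ fixed, $\Pi(S)^{\mathrm{Eq}}$ denotes the set of allocations of auto-bidder equilibria when advertiser $i$ reports $S$. $\mathrm{LW}_i(\pi)=T_i\sum_{j\in Q}\pi_{i,j}v_{i,j}$, where $T_i$ is the true target of $i$ (used on both sides of the inequality). Convention: the minimum over an empty set is $+\infty$. *)

(* Defs.v *)
From HB Require Import structures.
From mathcomp Require Import all_boot all_order all_algebra.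
From mathcomp Require Import boolp classical_sets reals constructive_ereal.

Set Implicit Arguments.
Unset Strict Implicit.
Unset Printing Implicit Defensive.

Import Order.TTheory GRing.Theory Num.Theory.
Local Open Scope ring_scope.

Section Autobidding.
Variables (R : realType) (A Q : finType).

Definition bid_profile := A -> Q -> R.

(* [pi (i, j)] is the indicator that bidder [i] wins query [j]. *)
Definition allocation := {ffun A * Q -> bool}.

(* A deterministic rule choosing, on every query, a bidder with the highest
   bid.  The choice may depend on the query and on all the bids placed on it;
   nothing is required at vectors with a negative entry, which are not bids. *)
Definition highest_bid_rule (w : Q -> (A -> R) -> A) : Prop :=
  forall (j : Q) (x : A -> R),
    (forall l, 0 <= x l) -> forall l, x l <= x (w j x).

Definition nonneg_bids (b : bid_profile) : Prop := forall i j, 0 <= b i j.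

Definition spa_alloc (w : Q -> (A -> R) -> A) (b : bid_profile) : allocation :=
  [ffun p => w p.2 (b ^~ p.2) == p.1].

(* The base value 0 is harmless: bids are nonnegative, and the index set is
   nonempty as soon as there are two bidders. *)
Definition spa_cost (b : bid_profile) (i : A) (j : Q) : R :=
  \big[Num.max/0]_(l | l != i) b l j.

Definition spa_payment (w : Q -> (A -> R) -> A) (b : bid_profile) (i : A) : R :=
  \sum_(j : Q) (spa_alloc w b (i, j))%:R * spa_cost b i j.

Definition alloc_value (v : A -> Q -> R) (pi : allocation) (i : A) : R :=
  \sum_(j : Q) (pi (i, j))%:R * v i j.

Definition deviate (b : bid_profile) (i : A) (b' : Q -> R) : bid_profile :=
  fun l => if l == i then b' else b l.

Definition undominated (v : A -> Q -> R) (S : A -> R) (b : bid_profile) (i : A)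
    : Prop :=
  forall j, S i * v i j <= b i j.

Definition tcpa_feasible (w : Q -> (A -> R) -> A) (v : A -> Q -> R)
    (S : A -> R) (b : bid_profile) (i : A) : Prop :=
  spa_payment w b i <= S i * alloc_value v (spa_alloc w b) i.

Definition stable (w : Q -> (A -> R) -> A) (v : A -> Q -> R)
    (S : A -> R) (b : bid_profile) (i : A) : Prop :=
  forall b' : Q -> R, (forall j, 0 <= b' j) ->
    let d := deviate b i b' in
    S i * alloc_value v (spa_alloc w d) i
      <= S i * alloc_value v (spa_alloc w b) i
    \/ S i * alloc_value v (spa_alloc w d) i < spa_payment w d i.

Definition autobidder_equilibrium (w : Q -> (A -> R) -> A) (v : A -> Q -> R)
    (S : A -> R) (b : bid_profile) : Prop :=
  nonneg_bids b /\
  forall i, [/\ undominated v S b i, tcpa_feasible w v S b i & stable w v S b i].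

Definition report (T : A -> R) (i : A) (s : R) : A -> R :=
  fun l => if l == i then s else T l.

Definition eq_allocations (w : Q -> (A -> R) -> A) (v : A -> Q -> R)
    (S : A -> R) : set allocation :=
  [set pi | exists2 b, autobidder_equilibrium w v S b & pi = spa_alloc w b]%classic.

Definition LW (v : A -> Q -> R) (Ti : R) (i : A) (pi : allocation) : R :=
  Ti * alloc_value v pi i.

(* There are finitely many allocations, so this is a genuine minimum; it is
   +oo on the empty set. *)
Definition min_over (P : set allocation) (f : allocation -> R) : \bar R :=
  \big[Order.min/+oo%E]_(pi : allocation | pi \in P) (f pi)%:E.

End Autobidding.

(* Main.v *)
Require Import Defs.
From mathcomp Require Import all_boot all_order all_algebra.
From mathcomp Require Import boolp classical_sets reals constructive_ereal.

(** Let [p_l(j)] be the highest target-weighted value [S_k v_(k,j)] over [k != l].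
    An assignment [g] of queries to winners is an equilibrium allocation if and
    only if every bidder [l] can afford its queries at the prices [p_l(j)]:
    undominated bids make these prices a lower bound on the costs and, conversely,
    they are the costs when losers bid [S_k v_(k,j)] and winners bid so high that
    no deviation can afford a foreign query.  When bidder [i] lowers its report,
    give each query it won to the bidder with the highest target-weighted value.
    Each such query pays for itself, the other queries do not get more expensive,
    and [i] wins no new query. *)

Local Open Scope ring_scope.
Import Order.TTheory GRing.Theory Num.Theory.

Section Assignments.
Context {R : realType} {A Q : finType}.
Implicit Types (w : Q -> (A -> R) -> A) (v : A -> Q -> R) (S : A -> R).
Implicit Types (b : bid_profile R A Q) (g : Q -> A).

Definition weighted_value S v : bid_profile R A Q := fun l j => S l * v l j.

Definition assignment_alloc g : allocation A Q := [ffun p => g p.2 == p.1].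

(** Feeding the weighted values to [spa_cost] as if they were bids yields the prices $p_l(j)$, so no
    bid profile is left in the condition. *)
Definition affordable S v g l : Prop :=
  \sum_j (g j == l)%:R * spa_cost (weighted_value S v) l j
    <= S l * \sum_j (g j == l)%:R * v l j.

Lemma spa_allocE w b : spa_alloc w b = assignment_alloc (fun j => w j (b ^~ j)).
Proof. by []. Qed.

Lemma alloc_value_assignment v g l :
  alloc_value v (assignment_alloc g) l = \sum_j (g j == l)%:R * v l j.
Proof. by apply: eq_bigr => j _; rewrite ffunE. Qed.

Lemma le_alloc_value v (pi pi' : allocation A Q) l :
  (forall j, 0 <= v l j) -> (forall j, pi (l, j) -> pi' (l, j)) ->
  alloc_value v pi l <= alloc_value v pi' l.
Proof.
move=> v0 le_pi; apply: ler_sum => j _; apply: ler_wpM2r => //.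
by rewrite ler_nat; case: (pi (l, j)) (le_pi j) => // ->.
Qed.

Lemma alloc_value_le_total v (pi : allocation A Q) l :
  (forall j, 0 <= v l j) -> alloc_value v pi l <= \sum_j v l j.
Proof.
move=> v0; apply: ler_sum => j _; rewrite ler_piMl //.
by case: (pi (l, j)) => //=; rewrite ler01.
Qed.

Lemma spa_cost_ge0 b l j : 0 <= spa_cost b l j.
Proof. exact: bigmax_ge_id. Qed.

Lemma le_bid_spa_cost b l k j : k != l -> b k j <= spa_cost b l j.
Proof. by move=> kl; apply: (le_bigmax_cond _ (fun k => b k j)). Qed.

Lemma le_spa_cost b b' l j :
  (forall k, k != l -> b k j <= b' k j) -> spa_cost b l j <= spa_cost b' l j.
Proof. by move=> le_b; apply: le_bigmax2. Qed.

Lemma spa_cost_le b l j x :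
  0 <= x -> (forall k, b k j <= x) -> spa_cost b l j <= x.
Proof. by move=> x0 bx; apply: bigmax_le. Qed.

Lemma affordable_equilibrium w v S b l :
  autobidder_equilibrium w v S b -> affordable S v (fun j => w j (b ^~ j)) l.
Proof.
move=> [_ eq_b]; have [_ feas _] := eq_b l.
move: feas; rewrite /tcpa_feasible spa_allocE alloc_value_assignment.
apply: le_trans; apply: ler_sum => j _.
rewrite ffunE; apply: ler_wpM2l; first exact: ler0n.
by apply: le_spa_cost => k _; have [und _ _] := eq_b k; apply: und.
Qed.

(** The winning bid exceeds $S_l \sum_j v_{l,j}$ for every bidder [l] at once. The summand 1 makes
    this strict, so the winner is the only highest bidder and ties never matter. *)
Definition shielding_bids S v g : bid_profile R A Q :=
  fun l j => if g j == l then 1 + \sum_k S k * \sum_j' v k j'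
             else weighted_value S v l j.

Section Shielding.
Context {w : Q -> (A -> R) -> A} {v : A -> Q -> R} {S : A -> R} {g : Q -> A}.
Hypotheses (hw : highest_bid_rule w) (v0 : forall l j, 0 <= v l j).
Hypothesis S0 : forall l, 0 <= S l.

Let total l : S l * \sum_j v l j < 1 + \sum_k S k * \sum_j v k j.
Proof.
have le0 k : 0 <= S k * \sum_j v k j by rewrite mulr_ge0 // sumr_ge0.
by rewrite (bigD1 l) //= addrCA ltrDl ltr_wpDr ?ltr01 // sumr_ge0.
Qed.

Let weighted_lt l j : weighted_value S v l j < 1 + \sum_k S k * \sum_j v k j.
Proof.
apply: le_lt_trans (total l); apply: ler_wpM2l => //.
by rewrite (bigD1 j) //= lerDl sumr_ge0.
Qed.

Lemma weighted_value_ge0 l j : 0 <= weighted_value S v l j.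
Proof. exact: mulr_ge0. Qed.

Lemma le_weighted_shielding l j :
  weighted_value S v l j <= shielding_bids S v g l j.
Proof. by rewrite /shielding_bids; case: ifP => // _; apply/ltW. Qed.

Lemma shielding_ge0 : nonneg_bids (shielding_bids S v g).
Proof.
by move=> l j; apply: le_trans (le_weighted_shielding l j); apply: weighted_value_ge0.
Qed.

Lemma spa_alloc_shielding :
  spa_alloc w (shielding_bids S v g) = assignment_alloc g.
Proof.
rewrite spa_allocE; congr assignment_alloc; apply/funext => j.
have := hw j (shielding_bids S v g ^~ j) (shielding_ge0 ^~ j) (g j).
rewrite {1}/shielding_bids eqxx {1}/shielding_bids.
by case: eqP => // _; rewrite leNgt weighted_lt.
Qed.

Lemma equilibrium_shielding :
  (forall l, affordable S v g l) ->
  autobidder_equilibrium w v S (shielding_bids S v g).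
Proof.
move=> aff; split; first exact: shielding_ge0.
move=> l; split.
- by move=> j; apply: le_weighted_shielding.
- rewrite /tcpa_feasible /spa_payment spa_alloc_shielding alloc_value_assignment.
  apply: le_trans (aff l); apply: ler_sum => j _; rewrite ffunE /=.
  have [gj|_] := eqVneq (g j) l; last by rewrite !mul0r.
  rewrite !mul1r; apply: le_spa_cost => k kl.
  by rewrite /shielding_bids gj eq_sym (negPf kl).
move=> b' b'0 /=; set d := deviate _ _ _.
(* Either the deviation wins some query assigned to another bidder, whose price alone exceeds all
   the value [l] could ever get, or it wins only queries that [l] already has. *)
have [/existsP[j /andP[win gj]]|/existsPn own] :=
    boolP [exists j, spa_alloc w d (l, j) && (g j != l)]; [right|left].
- apply: (@le_lt_trans _ _ (S l * \sum_j v l j)).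
    by apply: ler_wpM2l => //; apply: alloc_value_le_total.
  apply: lt_le_trans (total l) _.
  rewrite /spa_payment (bigD1 j) //= win mul1r.
  apply: ler_wpDr; first by apply: sumr_ge0 => ? _; rewrite mulr_ge0 ?spa_cost_ge0.
  apply: le_trans (le_bid_spa_cost _ _ _ _ gj).
  by rewrite /d /deviate (negPf gj) /shielding_bids eqxx.
apply: ler_wpM2l => //; apply: le_alloc_value => // j win.
by have := own j; rewrite spa_alloc_shielding win ffunE negbK.
Qed.

End Shielding.

(** The auction rule [w], run on the weighted values, serves as the argmax; [i] may keep a query. *)
Definition reassign w v S i g : Q -> A :=
  fun j => if g j == i then w j (weighted_value S v ^~ j) else g j.

Lemma affordable_reassign w v S S' i g :
  highest_bid_rule w -> (forall l j, 0 <= v l j) -> (forall l, 0 <= S' l) ->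
  (forall l, l != i -> S' l = S l) -> S' i <= S i ->
  (forall l, affordable S v g l) ->
  forall l, affordable S' v (reassign w v S' i g) l.
Proof.
move=> hw v0 S'0 S'E S'i aff l.
have S'S k : S' k <= S k by have [->//|ki] := eqVneq k i; rewrite S'E.
(* A query pays for itself when its owner has the highest weighted value, which then bounds the
   price. *)
have self j : w j (weighted_value S' v ^~ j) = l ->
    spa_cost (weighted_value S' v) l j <= S' l * v l j.
  move=> wl; apply: spa_cost_le => [|k]; first exact: mulr_ge0.
  rewrite -[S' l * _]/(weighted_value S' v l j) -wl.
  by apply: (hw j (weighted_value S' v ^~ j)) => ?; apply: mulr_ge0.
rewrite /affordable mulr_sumr -subr_le0 -sumrB.
have [li|li] := eqVneq l i.
  apply: sumr_le0 => j _; rewrite mulrCA -mulrBr /reassign li.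
  have [gi|gi] := eqVneq (g j) i; last by rewrite (negPf gi) mul0r.
  have [wi|_] := eqVneq (w j _) i; last by rewrite mul0r.
  by rewrite mul1r subr_le0 -li; apply: self; rewrite wi li.
(* For [l != i], cost minus value is compared with the old assignment query by query. A query taken
   from [i] contributed 0 before and contributes at most 0 now; on any other query the price can
   only drop, while the target of [l] is unchanged. *)
have := aff l; rewrite /affordable mulr_sumr -subr_le0 -sumrB.
apply: le_trans; apply: ler_sum => j _.
rewrite !(mulrCA (_ l)) -!mulrBr /reassign.
have [gi|gi] := eqVneq (g j) i.
  rewrite gi [i == l]eq_sym (negPf li) mul0r.
  have [wl|_] := eqVneq (w j _) l; last by rewrite mul0r.
  by rewrite mul1r subr_le0; apply: self.
apply: ler_wpM2l; first exact: ler0n.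
rewrite S'E // lerB //; apply: le_spa_cost => k _.
exact: ler_wpM2r.
Qed.

(** Empty sets fit in: if [P'] is empty, so is [P], and both minima are [+oo]. *)
Lemma le_min_over (P P' : set (allocation A Q)) (f : allocation A Q -> R) :
  (forall pi, P pi -> exists2 pi', P' pi' & f pi' <= f pi) ->
  (min_over P' f <= min_over P f)%E.
Proof.
move=> PP'; apply: le_bigmin => [|pi /set_mem /PP'[pi' P'pi' le_f]].
  exact: bigmin_le_id.
apply: (@le_trans _ _ (f pi')%:E); last by rewrite lee_fin.
by apply: (bigmin_le_cond _ (fun pi => (f pi)%:E)); apply: mem_set.
Qed.

End Assignments.

Theorem theorem1 (R : realType) (A Q : finType) (hA : (2 <= #|A|)%N)
  (w : Q -> (A -> R) -> A) (hw : highest_bid_rule w)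
  (v : A -> Q -> R) (hv : forall i j, 0 <= v i j)
  (i : A) (Ti : R) (hTi : 0 < Ti)
  (T : A -> R) (hT : forall l, l != i -> 0 < T l)
  (Ti' : R) (hTi' : 0 < Ti') (hle : Ti' <= Ti) :
  (min_over (eq_allocations w v (report T i Ti')) (LW v Ti i)
   <= min_over (eq_allocations w v (report T i Ti)) (LW v Ti i))%E.
Proof.
set S' := report T i Ti'.
have S'0 l : 0 <= S' l.
  by rewrite /S' /report; case: eqVneq => [_|/hT]; apply: ltW.
apply: le_min_over => pi [b eq_b ->].
pose g' := reassign w v S' i (fun j => w j (b ^~ j)).
exists (assignment_alloc g').
  exists (shielding_bids S' v g'); last by rewrite spa_alloc_shielding.
  apply: equilibrium_shielding => //.
  apply: (affordable_reassign _ _ (report T i Ti)) => //.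
  - by move=> l /negPf li; rewrite /S' /report li.
  - by rewrite /S' /report eqxx.
  - by move=> l; apply: affordable_equilibrium.
(* The true target [Ti] weighs both sides, so it suffices that every query [i] wins under [g'] was
   already won under [b]. *)
rewrite /LW ler_pM2l //; apply: le_alloc_value => // j.
rewrite !ffunE /= /g' /reassign.
by have [] := boolP (w j (b ^~ j) == i) => [|/negPf ->].
Qed.
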